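(* Let $p$ be a prime and $d,u$ positive integers with $u\ge 2$ if $p=2$, and let $\Gamma=\mathrm{CS}(u,d,p)$. If $k$ is a field of characteristic $p$, then the group ring $k[\Gamma]$ is a domain.
   Context: $\mathrm{CS}(i,d,p)=\{A\in \mathrm{Mat}_d(\mathbb{Z}_p)\mid A\equiv I_d \bmod p^i\}$, where $\mathbb{Z}_p$ denotes the $p$-adic integers; this is a group under matrix multiplication. *)

(* Defs.v *)
From mathcomp Require Import all_boot all_order all_algebra.
From Stdlib Require Import ClassicalDescription.
Set Implicit Arguments. Unset Strict Implicit. Unset Printing Implicit Defensive.
Import Order.TTheory GRing.Theory Num.Theory.
Local Open Scope ring_scope.

(* Mat_d(Z_p) realised as the inverse limit of Mat_d(Z/p^n Z):        *)
(* a matrix over Z_p is a family A : nat -> 'M[int]_d where A n is the *)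
(* reduction of the matrix mod p^n, with entries normalised in        *)
(* [0, p^n), and A n = (A n.+1 mod p^n).                               *)

Definition mod_mx (d : nat) (m : int) (A : 'M[int]_d) : 'M[int]_d :=
  map_mx (fun x => (x %% m)%Z) A.

Definition padic_mx (d : nat) := nat -> 'M[int]_d.

Definition is_padic_mx (p d : nat) (A : padic_mx d) : Prop :=
  forall n : nat, A n = mod_mx ((p ^ n)%N)%:Z (A n.+1).

Definition padic_mul (p d : nat) (A B : padic_mx d) : padic_mx d :=
  fun n => mod_mx ((p ^ n)%N)%:Z (A n *m B n).

Definition CS (i d p : nat) (A : padic_mx d) : Prop :=
  is_padic_mx p A /\ A i = mod_mx ((p ^ i)%N)%:Z 1%:M.

(* Group ring k[G] for a group G given as a predicate on a carrier    *)
(* with multiplication mul.  An element is represented by a finite    *)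
(* formal sum  sum_j a_j g_j  (a seq of pairs (a_j, g_j), g_j in G);  *)
(* two formal sums denote the same element iff they have the same     *)
(* coefficient function.                                               *)

Definition gr_coef (k : nzRingType) (T : Type) (f : seq (k * T)) (g : T) : k :=
  \sum_(a <- f) (if excluded_middle_informative (a.2 = g) then a.1 else 0).

Definition gr_mul (k : nzRingType) (T : Type) (mul : T -> T -> T)
  (f h : seq (k * T)) : seq (k * T) :=
  [seq (a.1 * b.1, mul a.2 b.2) | a <- f, b <- h].

Definition gr_supported (k : nzRingType) (T : Type) (G : T -> Prop)
  (f : seq (k * T)) : Prop :=
  forall a, List.In a f -> G a.2.

Definition gr_nonzero (k : nzRingType) (T : Type) (f : seq (k * T)) : Prop :=
  exists g, gr_coef f g != 0.

(* k[G] is a domain: 1 <> 0 (automatic for a field) and the product of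
   two nonzero elements is nonzero. *)
Definition group_ring_domain (k : nzRingType) (T : Type) (G : T -> Prop)
  (mul : T -> T -> T) : Prop :=
  forall f h : seq (k * T),
    gr_supported G f -> gr_supported G h ->
    gr_nonzero f -> gr_nonzero h -> gr_nonzero (gr_mul mul f h).

(* Main.v *)
From HB Require Import structures.
Require Import Defs.
From mathcomp Require Import all_boot all_order all_algebra.
From mathcomp Require Import all_fingroup all_solvable all_field all_character.
From mathcomp Require Import mpoly zify ssrAC.
From Stdlib Require Import Classical ClassicalDescription FunctionalExtensionality.
Set Implicit Arguments. Unset Strict Implicit. Unset Printing Implicit Defensive.
Import GRing.Theory.
Local Open Scope ring_scope.

(** Let P be the image of Gamma in GL_d(Z/p^M), of order q^D with q = p^(M-u) and
    D = d^2, and let I be the augmentation ideal of k[P], which is nilpotent since P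
    is a p-group. Every element of Gamma congruent to 1 modulo p^(u+j) is a product of
    p^j-th powers modulo higher congruence subgroups, so that h - 1 lies in I^(p^j);
    in particular commutators, being congruent to 1 modulo p^(2u), are trivial modulo
    I^3. Hence the graded ring of k[P] is commutative and generated by the D classes
    of g_i - 1, g_i = 1 + p^u E_i, whose q-th powers vanish. Comparing dimensions, it
    is the truncated polynomial ring k[X_1..X_D]/(X_i^q), so leading forms whose
    degrees add up to less than q multiply as in a polynomial ring. For a nonzero
    element of k[Gamma], the degree of the leading form stays bounded as M grows,
    because it is bounded as soon as the image in one k[P] is nonzero. *)

(** * Noncommutative ring identities for products and commutators *)

Lemma mulr_1D (R : pzRingType) (u v : R) : (1 + u) * (1 + v) = u * v + (u + v + 1).
Proof. by rewrite mulrDl mul1r mulrDr mulr1 (AC (2*2) (4*(3*2*1))). Qed.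

Lemma commrM_r (R : pzRingType) (x y z : R) :
  x * (y * z) - y * z * x = (x * y - y * x) * z + y * (x * z - z * x).
Proof. by rewrite mulrBl mulrBr !mulrA addrA subrK. Qed.

Lemma commrM_l (R : pzRingType) (x y z : R) :
  x * y * z - z * (x * y) = x * (y * z - z * y) + (x * z - z * x) * y.
Proof. by rewrite mulrBl mulrBr !mulrA addrA subrK. Qed.

(** * The augmentation filtration and its commutative graded ring *)

Section AugmentationFiltration.
Variables (k : fieldType) (A : algType k) (T : Type) (S : T -> bool).
Variable rho : T -> A.

(* The n-th power of the augmentation ideal (the whole algebra for n = 0). *)
Inductive augpow (n : nat) : A -> Prop :=
| augpow0 : augpow n 0
| augpow_prod s : all S s -> (n <= size s)%N ->
    augpow n (\prod_(g <- s) (rho g - 1))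
| augpowP c a b : augpow n a -> augpow n b -> augpow n (c *: a + b).

Lemma augpowD n a b : augpow n a -> augpow n b -> augpow n (a + b).
Proof. by move=> Fa Fb; rewrite -[a]scale1r; apply: augpowP. Qed.

Lemma augpowZ n c a : augpow n a -> augpow n (c *: a).
Proof. by move=> Fa; rewrite -[_ *: _]addr0; apply/augpowP/augpow0. Qed.

Lemma augpowN n a : augpow n a -> augpow n (- a).
Proof. by rewrite -scaleN1r; apply: augpowZ. Qed.

Lemma augpowB n a b : augpow n a -> augpow n b -> augpow n (a - b).
Proof. by move=> Fa /augpowN; apply: augpowD. Qed.

Lemma augpow_sum n (I : Type) (r : seq I) (P : pred I) (E : I -> A) :
  (forall i, P i -> augpow n (E i)) -> augpow n (\sum_(i <- r | P i) E i).
Proof.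
by move=> FE; elim/big_ind: _ => //; [apply: augpow0 | apply: augpowD].
Qed.

Lemma augpow_leq m n a : (m <= n)%N -> augpow n a -> augpow m a.
Proof.
move=> le_mn; elim=> [|s Ss le_ns|c {}a b _ Fa _ Fb].
- exact: augpow0.
- by apply: augpow_prod => //; apply: leq_trans le_ns.
- exact: augpowP.
Qed.

Lemma augpow_mul m n a b : augpow m a -> augpow n b -> augpow (m + n) (a * b).
Proof.
move=> Fa Fb; elim: Fa => [|s Ss ms|c {}a a' _ Fa _ Fa'].
- by rewrite mul0r; apply: augpow0.
- elim: Fb => [|t St nt|c {}b b' _ Fb _ Fb'].
  + by rewrite mulr0; apply: augpow0.
  + rewrite -big_cat; apply: augpow_prod; first by rewrite all_cat Ss.
    by rewrite size_cat leq_add.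
  + by rewrite mulrDr -scalerAr; apply: augpowP.
- by rewrite mulrDl -scalerAl; apply: augpowP.
Qed.

Lemma augpow_one : augpow 0 1.
Proof.
by have := @augpow_prod 0 [::] isT isT; rewrite big_nil.
Qed.

Lemma augpow_gen g : S g -> augpow 1 (rho g - 1).
Proof.
move=> Sg; rewrite -[rho g - 1](big_seq1 *%R g (fun g => rho g - 1)).
by apply: augpow_prod => //=; rewrite Sg.
Qed.

Lemma augpow_elt g : S g -> augpow 0 (rho g).
Proof.
move=> Sg; rewrite -[rho g](subrK 1); apply: augpowD augpow_one.
by apply: augpow_leq (augpow_gen Sg).
Qed.

Lemma augpowX n a i : augpow n a -> augpow (n * i) (a ^+ i).
Proof.
move=> Fa; elim: i => [|i IHi]; first by rewrite muln0; apply: augpow_one.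
by rewrite exprS mulnS; apply: augpow_mul.
Qed.

Hypothesis comm_rho : forall g h, S g -> S h ->
  augpow 3 (rho g * rho h - rho h * rho g).

Lemma augpow_comm_gen g h : S g -> S h ->
  augpow 3 ((rho g - 1) * (rho h - 1) - (rho h - 1) * (rho g - 1)).
Proof.
move=> Sg Sh; have := comm_rho Sg Sh.
have commB (v w : A) : (1 + v) * (1 + w) - (1 + w) * (1 + v) = v * w - w * v.
  by rewrite !mulr_1D [w + v]addrC opprD addrACA subrr addr0.
by have := commB (rho g - 1) (rho h - 1); rewrite ![1 + _]addrC !subrK => ->.
Qed.

(** A commutator is a derivation in each entry, so everything reduces to two generators [rho g - 1],
    whose commutator has degree 3 instead of 2. This makes the graded ring commutative. *)
Lemma augpow_comm m n a b :
  augpow m a -> augpow n b -> augpow (m + n).+1 (a * b - b * a).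
Proof.
have gen_list g t : S g -> all S t ->
    augpow (size t).+2 ((rho g - 1) * \prod_(h <- t) (rho h - 1)
                        - \prod_(h <- t) (rho h - 1) * (rho g - 1)).
  move=> Sg; elim: t => [_|h t IHt /= /andP[Sh St]].
    by rewrite big_nil mulr1 mul1r subrr; apply: augpow0.
  rewrite big_cons commrM_r.
  apply: augpowD.
    apply: (@augpow_leq _ (3 + size t)); first by lia.
    by apply: augpow_mul; [apply: augpow_comm_gen | apply: augpow_prod].
  by apply: (@augpow_mul 1 (size t).+2); [apply: augpow_gen | apply: IHt].
have list_list s t : all S s -> all S t ->
    augpow (size s + size t).+1 (\prod_(h <- s) (rho h - 1) * \prod_(h <- t) (rho h - 1)
                        - \prod_(h <- t) (rho h - 1) * \prod_(h <- s) (rho h - 1)).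
  move=> + St; elim: s => [_|g s IHs /= /andP[Sg Ss]].
    by rewrite big_nil mulr1 mul1r subrr; apply: augpow0.
  rewrite big_cons commrM_l.
  apply: augpowD.
    by apply: (@augpow_mul 1 (size s + size t).+1); [apply: augpow_gen | apply: IHs].
  apply: (@augpow_leq _ ((size t).+2 + size s)); first by lia.
  by apply: augpow_mul; [apply: gen_list | apply: augpow_prod].
move=> Fa Fb; elim: Fa => [|s Ss ms|c {}a a' _ Fa _ Fa'].
- by rewrite mul0r mulr0 subrr; apply: augpow0.
- elim: Fb => [|t St nt|c {}b b' _ Fb _ Fb'].
  + by rewrite mul0r mulr0 subrr; apply: augpow0.
  + by apply: augpow_leq (list_list _ _ Ss St); lia.
  + by rewrite mulrDr mulrDl opprD addrACA -scalerAr -scalerAl -scalerBr; apply: augpowP.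
- by rewrite mulrDr mulrDl opprD addrACA -scalerAr -scalerAl -scalerBr; apply: augpowP.
Qed.

Variables (D : nat) (e : 'I_D -> T).
Hypothesis Se : forall i, S (e i).

Local Notation x i := (rho (e i) - 1).
Local Notation mon := (mmap1 (fun i => x i)).
Local Notation phi := (mmap (in_alg A) (fun i => x i)).

Lemma augpow_prod_exp (r : seq 'I_D) (a : 'I_D -> nat) :
  augpow (\sum_(i <- r) a i) (\prod_(i <- r) x i ^+ a i).
Proof.
elim: r => [|i r IHr]; first by rewrite !big_nil; apply: augpow_one.
rewrite !big_cons; apply: augpow_mul => //.
by rewrite -{1}[a i]mul1n; apply/augpowX/augpow_gen.
Qed.

Lemma augpow_mon m : augpow (mdeg m) (mon m).
Proof. by rewrite mdegE; apply: augpow_prod_exp. Qed.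

(** Merging two monomials only reorders factors, and each swap costs a commutator one degree
    deeper. *)
Lemma augpow_monM m1 m2 :
  augpow (mdeg m1 + mdeg m2).+1 (mon m1 * mon m2 - mon (m1 + m2)%MM).
Proof.
rewrite !mdegE /mmap1.
under [X in _ - X]eq_bigr do rewrite mnmDE.
elim: (index_enum _) => [|i r IHr].
  by rewrite !big_nil mulr1 subrr; apply: augpow0.
have Fr1 := augpow_prod_exp r m1; have Fr2 := augpow_prod_exp r m2.
have Fx n : augpow n (x i ^+ n) by rewrite -{1}[n]mul1n; apply/augpowX/augpow_gen.
have F1 := Fx (m1 i); have F2 := Fx (m2 i).
rewrite !big_cons exprD.
move: (x i ^+ m1 i) (x i ^+ m2 i) F1 F2 => u v F1 F2.
move: IHr Fr1 Fr2; move: (\prod_(j <- r) x j ^+ (m1 j + m2 j)) => w.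
move: (\prod_(j <- r) _) (\prod_(j <- r) _) => z y.
move: (\sum_(j <- r) _)%N (\sum_(j <- r) _)%N => n2 n1 IHr Fr1 Fr2.
have -> : u * y * (v * z) - u * v * w =
    u * ((y * v - v * y) * z) + u * v * (y * z - w).
  by rewrite !(mulrBl, mulrBr) !mulrA addrA subrK.
apply: augpowD.
  apply: (@augpow_leq _ (m1 i + ((n1 + m2 i).+1 + n2))); first by lia.
  apply: augpow_mul => //; apply: augpow_mul => //; exact: augpow_comm.
apply: (@augpow_leq _ (m1 i + m2 i + (n1 + n2).+1)); first by lia.
by apply: augpow_mul => //; apply: augpow_mul.
Qed.

Lemma augpow_mmap n P : P \is n.-homog -> augpow n (phi P).
Proof.
move=> /dhomogP homP; rewrite /mmap big_seq; apply: augpow_sum => m /homP /= <-.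
by rewrite mulr_algl; apply/augpowZ/augpow_mon.
Qed.

Lemma mmap_in_algE P : phi P = \sum_(m <- msupp P) P@_m *: mon m.
Proof. by apply: eq_bigr => m _; rewrite mulr_algl. Qed.

Lemma mmap_in_algZ c P : phi (c *: P) = c *: phi P.
Proof. by rewrite mmapZ /= mulr_algl. Qed.

(** Expanding over monomials, [augpow_monM] bounds each term; so [phi] becomes multiplicative on the
    graded ring. *)
Lemma augpow_mmapM s t P Q :
  P \is s.-homog -> Q \is t.-homog ->
  augpow (s + t).+1 (phi P * phi Q - phi (P * Q)).
Proof.
move=> /dhomogP homP /dhomogP homQ.
have -> : phi (P * Q) = \sum_(m1 <- msupp P) \sum_(m2 <- msupp Q)
    (P@_m1 * Q@_m2) *: mon (m1 + m2)%MM.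
  rewrite mpolyME raddf_sum /= big_allpairs /=; apply: eq_bigr => m1 _.
  by apply: eq_bigr => m2 _; rewrite mmap_in_algZ mmapX.
rewrite !mmap_in_algE mulr_suml -sumrB big_seq; apply: augpow_sum => m1 m1P.
rewrite mulr_sumr -sumrB big_seq; apply: augpow_sum => m2 m2Q.
rewrite -scalerAl -scalerAr scalerA -scalerBr.
by apply: augpowZ; rewrite -(homP _ m1P) -(homQ _ m2Q); apply: augpow_monM.
Qed.

Hypothesis gen_rho : forall g, S g -> exists c : 'I_D -> k,
  augpow 2 (rho g - 1 - \sum_i c i *: x i).

(** In a product of exactly [n] generators, replacing each factor by its linear form changes the
    result only in degree [n.+1]; so the graded ring is generated by the classes of the [x i]. *)
Lemma augpow_lead n a : augpow n a -> exists2 P,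
  P \is n.-homog & augpow n.+1 (a - phi P).
Proof.
elim=> [|s Ss ns|c {}a b _ [P hP FP] _ [Q hQ FQ]].
- by exists 0; [apply: rpred0 | rewrite mmap0 subrr; apply: augpow0].
- move: ns; rewrite leq_eqVlt => /orP[/eqP ->|lt_ns]; last first.
    exists 0; first exact: rpred0.
    by rewrite mmap0 subr0; apply: augpow_prod.
  elim: s Ss => [_|g s IHs /= /andP[Sg Ss]].
    exists 1; first exact: dhomog1.
    by rewrite big_nil -mpolyX0 mmapX mmap11 subrr; apply: augpow0.
  have [P hP FP] := IHs Ss; have [c Fc] := gen_rho Sg.
  pose L : {mpoly k[D]} := \sum_i c i *: 'X_i.
  have hL : L \is 1.-homog.
    by apply: rpred_sum => i _; apply: rpredZ; rewrite dhomogX /= mdeg1.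
  have phiL : phi L = \sum_i c i *: x i.
    by rewrite raddf_sum /=; apply: eq_bigr => i _; rewrite mmap_in_algZ mmapX mmap1U.
  rewrite -phiL in Fc.
  exists (L * P); first by rewrite -add1n; apply: dhomogM.
  rewrite big_cons; set z := \prod_(_ <- _) _ in FP *.
  have -> : (rho g - 1) * z - phi (L * P) = (rho g - 1 - phi L) * z
      + phi L * (z - phi P) + (phi L * phi P - phi (L * P)).
    by rewrite [in RHS]mulrBl [in RHS]mulrBr !addrA !subrK.
  apply: augpowD; last exact: (augpow_mmapM hL hP).
  apply: augpowD.
    by apply: (@augpow_mul 2 (size s)) => //; apply: augpow_prod.
  by apply: (@augpow_mul 1 (size s).+1) => //; apply: augpow_mmap.
- exists (c *: P + Q); first by apply: rpredD => //; apply: rpredZ.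
  by rewrite raddfD /= mmap_in_algZ opprD addrACA -scalerBr; apply: augpowP.
Qed.

End AugmentationFiltration.

(** * Leading forms below degree [q] multiply as polynomials *)

Section LeadingForms.
Variables (k : fieldType) (A : falgType k) (T : finType) (S : {set T}).
Variables (rho : T -> A) (D : nat) (e : 'I_D -> T) (q L : nat).
Local Notation aug := (augpow (fun g => g \in S) rho).
Local Notation x i := (rho (e i) - 1).
Local Notation mon := (mmap1 (fun i => x i)).
Local Notation phi := (mmap (in_alg A) (fun i => x i)).
Hypothesis comm_rho : forall g h, g \in S -> h \in S ->
  aug 3 (rho g * rho h - rho h * rho g).
Hypothesis Se : forall i, e i \in S.
Hypothesis gen_rho : forall g, g \in S -> exists c : 'I_D -> k,
  aug 2 (rho g - 1 - \sum_i c i *: x i).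
Hypothesis free_rho : free (image rho S).
Hypothesis card_S : (q ^ D <= #|S|)%N.
Hypothesis expX : forall i, x i ^+ q = 0.
Hypothesis nilp : forall a, aug L a -> a = 0.

(* The truncated monomials span the q^D-dimensional algebra; a relation between leading
   forms would make one of them redundant. *)
Lemma mmap_notin_augpow n P : P \is n.-homog -> P != 0 -> (n < q)%N -> ~ aug n.+1 (phi P).
Proof.
move=> homP P0 ltnq FP.
have q_gt0 : (0 < q)%N by apply: leq_ltn_trans ltnq.
pose mm (f : {ffun 'I_D -> 'I_q}) : 'X_{1.. D} := [multinom (f i : nat) | i < D].
have mmP (m : 'X_{1.. D}) : (forall i, (m i < q)%N) -> exists f, mm f = m.
  move=> mq; exists [ffun i => Ordinal (mq i)].
  by apply/mnmP => i; rewrite mnmE ffunE.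
have [m0 m0P] : exists m, m \in msupp P.
  case E : (msupp P) => [|m r]; last by exists m; rewrite mem_head.
  by move: E => /eqP; rewrite msupp_eq0 (negPf P0).
have degP m : m \in msupp P -> mdeg m = n by move/dhomogP: homP; apply.
(* No exponent of [m0] exceeds its degree [n < q], so [m0] is a truncated monomial. *)
have [f0 mmf0] : exists f, mm f = m0.
  apply: mmP => i; apply: leq_ltn_trans ltnq; rewrite -(degP _ m0P) mdegE.
  by rewrite (bigD1 i) //= leq_addr.
pose V := <<[seq mon (mm f) | f in [set~ f0]]>>%VS.
have monV m : m != m0 -> mon m \in V.
  move=> mm0; case: (boolP [forall i, (m i < q)%N]) => [/forallP/mmP[f Ef]|].
    apply/memv_span/imageP; exists f; last by rewrite Ef.
    by rewrite !inE; apply: contraNneq mm0 => ff0; rewrite -Ef ff0 mmf0.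
  rewrite negb_forall => /existsP[i]; rewrite -leqNgt => qm.
  suff -> : mon m = 0 by apply: mem0v.
  rewrite /mmap1; have := mem_index_enum i; case/splitPr => r1 r2.
  by rewrite big_cat big_cons /= -(subnKC qm) exprD expX !mul0r mulr0.
(* Descending induction on [j]: from [L] on, the ideal powers vanish. *)
have augV N : forall j, (L <= j + N)%N -> forall a, aug j a -> a \in V.
  elim: N => [j|N IHN j lejL a Fa].
    by rewrite addn0 => leL a /(augpow_leq leL)/nilp->; apply: mem0v.
  have IH b : aug j.+1 b -> b \in V by apply: IHN; rewrite addSnnS.
  have [Q homQ FQ] := augpow_lead comm_rho Se gen_rho Fa.
  rewrite -[a](subrK (phi Q)); apply: memvD; first exact: IH.
  rewrite mmap_in_algE big_seq; apply: memv_suml => m mQ; apply: memvZ.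
  have [mm0|] := eqVneq m m0; last exact: monV.
  move: homQ => /dhomogP/(_ _ mQ) /= degm.
  (* Only in degree [n] can [m0] occur. There [phi P] already lies in [V] by induction, and solving
     for its term at [m0] puts [mon m0] in [V]. *)
  have jn : j = n by rewrite -degm mm0 (degP _ m0P).
  have /IH : aug j.+1 (phi P) by rewrite jn.
  rewrite mm0 mmap_in_algE (bigD1_seq m0) ?msupp_uniq //= => PV.
  have {PV} : P@_m0 *: mon m0 \in V.
    rewrite -[_ *: _](addrK (\sum_(m' <- msupp P | m' != m0) P@_m' *: mon m')).
    by apply: memvB => //; apply: memv_suml => m' m'm0; apply/memvZ/monV.
  by move/(memvZ (P@_m0)^-1); rewrite scalerA mulVf ?scale1r // -mcoeff_msupp.
have subV : (<<image rho S>> <= V)%VS.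
  apply/span_subvP => _ /imageP[g Sg ->].
  by apply: (augV L 0%N) => //; apply: augpow_elt.
(* The span of [rho] on [S] has dimension [#|S|], while [V] is spanned by [q ^ D - 1] vectors. *)
have := dimvS subV; rewrite (eqP free_rho) size_image leqNgt => /negP[].
apply: leq_ltn_trans (dim_span _) _; rewrite size_image.
apply: leq_trans card_S.
by rewrite cardsC1 card_ffun !card_ord prednK // expn_gt0 q_gt0.
Qed.

Lemma augpow_valuation a N : aug 0 a -> ~ aug N a ->
  exists n, [/\ (n < N)%N, aug n a & ~ aug n.+1 a].
Proof.
move=> Fa; elim: N => [//|N IHN nFa].
case: (classic (aug N a)) => [FN|/IHN[n [ltn Fn nFn]]]; first by exists N.
by exists n; split=> //; apply: ltnW.
Qed.

(** The leading forms of [a] and [b] have degrees [s < M] and [t < N], and their product is a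
    nonzero polynomial of degree [s + t < q]. If [a * b] were 0, [phi] would send it into degree
    [s + t + 1], against [mmap_notin_augpow]. *)
Lemma augpow_mul_neq0 a b M N : (M + N <= q)%N ->
  aug 0 a -> ~ aug M a -> aug 0 b -> ~ aug N b -> a * b <> 0.
Proof.
move=> MNq Fa nFa Fb nFb ab0.
have [s [ltsM Fs nFs]] := augpow_valuation Fa nFa.
have [t [lttN Ft nFt]] := augpow_valuation Fb nFb.
have [P homP FP] := augpow_lead comm_rho Se gen_rho Fs.
have [Q homQ FQ] := augpow_lead comm_rho Se gen_rho Ft.
have P0 : P != 0 by apply/eqP => P0; apply: nFs; move: FP; rewrite P0 mmap0 subr0.
have Q0 : Q != 0 by apply/eqP => Q0; apply: nFt; move: FQ; rewrite Q0 mmap0 subr0.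
apply: (@mmap_notin_augpow (s + t) (P * Q)).
- exact: dhomogM.
- by rewrite mulf_neq0.
- by lia.
have -> : phi (P * Q) = - (phi P * phi Q - phi (P * Q))
    - ((a - phi P) * b + phi P * (b - phi Q)).
  rewrite mulrBl mulrBr ab0 sub0r addKr opprK opprB.
  by rewrite subrK.
apply: augpowB; first by apply/augpowN/augpow_mmapM.
apply: augpowD; first by rewrite -addSn; apply: augpow_mul.
by rewrite -addnS; apply: augpow_mul => //; apply: augpow_mmap.
Qed.

End LeadingForms.

(** * Group algebras of finite [p]-groups in characteristic [p] *)

Section PGroupAlgebra.
Variables (k : fieldType) (p : nat) (gT : finGroupType) (G : {group gT}).
Hypotheses (pcharkp : p \in [pchar k]) (pG : (p.-group G)%g).

(* A nonzero fixed vector spans a trivial submodule; induct on the quotient. *)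
Lemma pgroup_repr_unipotent n (rG : mx_representation k G n) m s :
  (n <= m)%N -> all (fun g => g \in G) s -> (m <= size s)%N ->
  \prod_(g <- s) (rG g - 1) = 0.
Proof.
elim: m n rG s => [|m IHm] n rG s le_nm Gs le_ms; last case: (posnP n) => n_gt0.
- by apply/matrixP => i; case: (leq_trans (ltn_ord i) le_nm).
- by apply/matrixP => i; have := ltn_ord i; rewrite [X in (_ < X)%N]n_gt0.
pose U := rfix_mx rG G.
have nzU : U != 0 by apply: rfix_pgroup_pchar pcharkp _ _ _ _ _ _ _.
have modU : mxmodule rG U by apply: normal_rfix_mx_module.
case/lastP: s Gs le_ms => [//|s g]; rewrite all_rcons size_rcons => /andP[Gg Gs] le_ms.
pose rU := factmod_repr modU.
have le_rm : (\rank (cokermx U) <= m)%N.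
  by rewrite mxrank_coker leq_subLR -ltnS; move: nzU; rewrite -mxrank_eq0; lia.
have factE (W : 'M_n) : in_factmod U (W *m \prod_(h <- s) (rG h - 1)) =
    in_factmod U W *m \prod_(h <- s) (rU h - 1).
  elim: s Gs {le_ms} W => [|h s IHs] Gs W; first by rewrite !big_nil !mulmx1.
  move: Gs => /= /andP[Gh Gs].
  rewrite !big_cons !mulmxA IHs // [W *m _]mulmxBr linearB /= in_factmodJ //.
  by rewrite !mulmxBr !mulmx1.
(* By induction the product over [s] has its rows in the fixed space [U], which the last factor
   [rG g - 1] kills. *)
have : in_factmod U (\prod_(h <- s) (rG h - 1)) = 0.
  rewrite -[\prod_(h <- s) _]mul1mx factE IHm ?mulmx0 //.
move/eqP; rewrite in_factmod_eq0 => /rfix_mxP/(_ g Gg) fixg.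
by rewrite big_rcons /= mulrBr mulr1 -[_ * _]/(_ *m _) fixg subrr.
Qed.

Lemma group_algebra_exists : exists (A : falgType k) (rho : gT -> A),
  [/\ rho 1%g = 1, {in G &, {morph rho : g h / (g * h)%g >-> g * h}},
      free (image rho G)
    & forall a, augpow (fun g => g \in G) rho #|G| a -> a = 0].
Proof.
have [n [rG [n_gt0 le_nG freeG]]] : exists n (rG : mx_representation k G n),
    [/\ (0 < n)%N, (n <= #|G|)%N & free (image rG G)].
  exists (gcard G), (regular_repr k G); split; rewrite /gcard //.
  apply/(@freeP _ _ _ (image_tuple _ _)) => c c0 i.
  move/(congr1 (gring_proj (enum_val i))): c0; rewrite linear_sum linear0 /=.
  rewrite (bigD1 i) //= big1 => [|j ji]; rewrite linearZ /= nth_image.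
    rewrite gring_projE ?enum_valP // eqxx addr0 => /matrixP/(_ 0 0).
    by rewrite !mxE mulr1.
  rewrite gring_projE ?enum_valP // (inj_eq enum_val_inj) eq_sym (negPf ji).
  by rewrite scaler0.
case: n rG n_gt0 le_nG freeG => // n rG _ le_nG freeG.
exists 'M[k]_n.+1, rG; split.
- exact: repr_mx1.
- by move=> g h Gg Gh; rewrite repr_mxM.
- exact: freeG.
move=> a; elim=> // [s Gs le_s|c {}a b _ -> _ ->]; last by rewrite scaler0 addr0.
exact: pgroup_repr_unipotent Gs le_s.
Qed.
End PGroupAlgebra.

(** * Linear extension from group elements, and transport of the filtration *)

Lemma linear_extension (k : fieldType) (V : vectType k) (T : finType) (S : {set T})
    (rho : T -> V) (W : lmodType k) (t : T -> W) : free (image rho S) ->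
  exists f : {linear V -> W}, {in S, forall g, f (rho g) = t g}.
Proof.
move=> freeS; have [f fE] := linear_of_free (image rho S) (image t S).
exists f => g Sg; have := fE freeS; rewrite !size_image => /(_ erefl).
by rewrite -map_comp => /eq_in_map; apply; rewrite mem_enum.
Qed.

Lemma augpow_morph (k : fieldType) (A : falgType k) (B : algType k)
    (gT rT : finGroupType) (G : {group gT}) (H : {group rT})
    (rho : gT -> A) (sigma : rT -> B) (f : gT -> rT) (F : {linear A -> B}) :
  rho 1%g = 1 -> {in G &, {morph rho : g h / (g * h)%g >-> g * h}} ->
  sigma 1%g = 1 -> {in H &, {morph sigma : g h / (g * h)%g >-> g * h}} ->
  {in G, forall g, f g \in H} -> f 1%g = 1%g ->
  {in G &, {morph f : g h / (g * h)%g}} ->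
  {in G, forall g, F (rho g) = sigma (f g)} ->
  forall n a, augpow (fun g => g \in G) rho n a ->
    augpow (fun g => g \in H) sigma n (F a).
Proof.
move=> rho1 rhoM sig1 sigM fGH f1 fM FE n a.
elim=> [|s Gs le_ns|c {}a b _ Fa _ Fb].
- by rewrite linear0; apply: augpow0.
(* [F] is multiplicative only on the span of the [rho g], so a front factor [rho h] carries the
   induction: peeling off [rho g - 1] leaves the front factors [rho (h * g)] and [rho h]. *)
- suff FM h : h \in G -> F (rho h * \prod_(g <- s) (rho g - 1)) =
      sigma (f h) * \prod_(g <- map f s) (sigma g - 1).
    have := FM 1%g (group1 G); rewrite rho1 f1 sig1 !mul1r => ->.
    apply: augpow_prod; last by rewrite size_map.
    by rewrite all_map; apply: sub_all Gs => g; apply: fGH.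
  elim: s Gs {le_ns} h => [_ h Gh|g s IHs /= /andP[Gg Gs] h Gh].
    by rewrite !big_nil !mulr1 FE.
  rewrite !big_cons !mulrA !mulrBr !mulr1 -rhoM // -sigM ?fGH // -fM //.
  by rewrite !mulrBl linearB /= !IHs ?groupM.
- by rewrite linearP; apply: augpowP.
Qed.

Lemma expr_pchar_sub1 (R : nzRingType) (p n : nat) (x : R) : p \in [pchar R] ->
  (x - 1) ^+ (p ^ n) = x ^+ (p ^ n) - 1.
Proof.
move=> charRp; elim: n => [|n IHn]; first by rewrite !expr1.
rewrite expnSr !exprM IHn.
have := pFrobenius_autB_comm charRp (commr1 (x ^+ (p ^ n))).
by rewrite !pFrobenius_autE expr1n.
Qed.

(** * Congruence subgroups of the units of a finite ring in which [p ^ M = 0] *)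

Section CongruenceGroups.
Variables (R : finUnitRingType) (p M : nat).
Hypotheses (p_pr : prime p) (pM0 : (p ^ M)%:R = 0 :> R).

Definition cong1 i (a : R) := [exists b : R, a == 1 + b *+ p ^ i].

Lemma cong1P i a : reflect (exists b, a = 1 + b *+ p ^ i) (cong1 i a).
Proof. by apply: (iffP existsP) => -[b /eqP ab]; exists b; rewrite ?ab. Qed.

Lemma cong1_1 i : cong1 i 1.
Proof. by apply/cong1P; exists 0; rewrite mul0rn addr0. Qed.

Lemma cong1M i a b : cong1 i a -> cong1 i b -> cong1 i (a * b).
Proof.
move=> /cong1P[c ->] /cong1P[d ->]; apply/cong1P; exists (d + c + c * d *+ p ^ i).
by rewrite mulrDl mul1r mulrDr mulr1 mulrnAr mulrnAl !mulrnDl !addrA.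
Qed.

Lemma cong1X i a n : cong1 i a -> cong1 i (a ^+ n).
Proof.
by move=> ca; elim: n => [|n IHn]; rewrite ?cong1_1 // exprS cong1M.
Qed.

Lemma cong1_leq i j a : (j <= i)%N -> cong1 i a -> cong1 j a.
Proof.
move=> le_ji /cong1P[b ->]; apply/cong1P; exists (b *+ p ^ (i - j)).
by rewrite -mulrnA -expnD subnK.
Qed.

Lemma cong1_full i a : (M <= i)%N -> cong1 i a -> a = 1.
Proof.
move=> le_Mi /(cong1_leq le_Mi)/cong1P[b ->].
by rewrite -mulr_natr pM0 mulr0 addr0.
Qed.

(** Factor [a ^+ p - 1] as [a - 1] times the sum of the [a ^+ j] for [j < p]; each power is 1 modulo
    [p], so the sum is divisible by [p]. *)
Lemma cong1_expp i a : (0 < i)%N -> cong1 i a -> cong1 i.+1 (a ^+ p).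
Proof.
move=> i_gt0 ca; have /cong1P[b ab] := ca.
have [c Sc] : exists c, \sum_(j < p) a ^+ j = c *+ p.
  have [s aj] : exists s : 'I_p -> R, forall j : 'I_p, a ^+ j = 1 + s j *+ p.
    have aj (j : 'I_p) : exists b, a ^+ j = 1 + b *+ p.
      by have /cong1P[d] := cong1X j (cong1_leq i_gt0 ca); exists d.
    by have [s sP] := fin_all_exists aj; exists s.
  exists (1 + \sum_(j < p) s j); under eq_bigr do rewrite aj.
  by rewrite big_split /= sumr_const card_ord sumrMnl mulrnDl.
apply/cong1P; exists (b * c); apply: (addrI (-1)); rewrite addrC subrX1 Sc.
by rewrite ab [1 + _]addrC addrK addKr mulrnAl mulrnAr -mulrnA -expnS.
Qed.

Lemma cong1_expX i n a : (0 < i)%N -> cong1 i a -> cong1 (i + n) (a ^+ (p ^ n)).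
Proof.
move=> i_gt0 ca; elim: n => [|n IHn]; first by rewrite addn0.
by rewrite expnSr exprM addnS cong1_expp ?addn_gt0 ?i_gt0.
Qed.

(** Each [p]-th power gains one congruence level. This makes elements invertible, bounds the
    exponent of the group and truncates the powers of the generators. *)
Lemma cong1_exp1 i a : (0 < i)%N -> cong1 i a -> a ^+ (p ^ (M - i)) = 1.
Proof.
by move=> i_gt0 /(cong1_expX (M - i) i_gt0); apply: cong1_full; rewrite -leq_subLR.
Qed.

Lemma cong1_unit i a : (0 < i)%N -> cong1 i a -> a \is a GRing.unit.
Proof.
move=> i_gt0 /(cong1_exp1 i_gt0) a1.
by rewrite -(@unitrX_pos _ _ (p ^ (M - i))) ?a1 ?unitr1 // expn_gt0 prime_gt0.
Qed.

Definition congset i : {set {unit R}} := [set g | cong1 i (val g)].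

Lemma congset_group i : group_set (congset i).
Proof.
apply/group_setP; split=> [|g h]; rewrite !inE; first exact: cong1_1.
exact: cong1M.
Qed.
Canonical congG i := Group (congset_group i).

Lemma congG_pgroup i : (0 < i)%N -> (p.-group (congG i))%g.
Proof.
move=> i_gt0; rewrite -pnat_exponent.
apply: (@pnat_dvd _ (p ^ (M - i))); last by rewrite pnatX pnat_id.
apply/exponentP => g; rewrite inE => /(cong1_exp1 i_gt0) g1.
by apply: val_inj; rewrite FinRing.val_unitX.
Qed.

Lemma congG_leq i j g : (j <= i)%N -> g \in congG i -> g \in congG j.
Proof. by move=> le_ji; rewrite !inE; apply: cong1_leq. Qed.

Lemma congG_div i (g h : {unit R}) c : val h = val g + c *+ p ^ i -> (g^-1 * h)%g \in congG i.
Proof.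
move=> hg; rewrite inE FinRing.val_unitM hg mulrDr FinRing.val_unitV.
have Ug : val g \is a GRing.unit by apply: valP.
by rewrite mulVr // mulrnAr; apply/cong1P; exists ((val g)^-1 * c).
Qed.

(** For [h] equal to 1 + b p^(i+1) take [g] equal to 1 + b p^i: the binomial terms of [g ^+ p] of
    degrees 0 and 1 give [h], and the others are divisible by [p ^ i.+2]. *)
Lemma congG_root i h : (0 < i)%N -> (p = 2%N -> 2 <= i)%N -> h \in congG i.+1 ->
  exists g h', [/\ g \in congG i, h' \in congG i.+2 & h = (g ^+ p * h')%g].
Proof.
move=> i_gt0 i_gt1; rewrite inE => /cong1P[b hb].
have cg : cong1 i (1 + b *+ p ^ i) by apply/cong1P; exists b.
pose g : {unit R} := FinRing.unit R (cong1_unit i_gt0 cg).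
have [c gc] : exists c, val g ^+ p = val h + c *+ p ^ i.+2.
  (* Inner binomial coefficients supply a factor [p]. The last one is 1, and then [i * p >= i + 2]
     takes [i >= 2] when [p = 2]. *)
  have dvdC j : (p ^ i.+2 %| p ^ (i * j.+2) * 'C(p, j.+2))%N.
    have [ltjp|] := ltnP j.+2 p.
      apply: (@dvdn_trans (p ^ (i * j.+2) * p)); last first.
        by rewrite dvdn_mul // prime_dvd_bin //.
      rewrite -expnSr dvdn_exp2l //; nia.
    rewrite leq_eqVlt => /orP[/eqP pj|ltpj]; last by rewrite bin_small ?muln0.
    rewrite -pj binn muln1 dvdn_exp2l //.
    have := prime_gt1 p_pr; rewrite leq_eqVlt => /orP[/eqP p2|]; last by nia.
    by have := i_gt1 (esym p2); rewrite -p2; lia.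
  exists (\sum_(j < p.-1) b ^+ j.+2 *+ ((p ^ (i * j.+2) * 'C(p, j.+2)) %/ p ^ i.+2)).
  rewrite /= [1 + _]addrC exprD1n -(prednK (prime_gt0 p_pr)) !big_ord_recl /=.
  rewrite !(prednK (prime_gt0 p_pr)) bin0 expr0 mulr1n bin1 expr1 addrA hb -mulrnA.
  rewrite -expnSr; congr (_ + _); rewrite -sumrMnl; apply: eq_bigr => j _.
  by rewrite /bump /= !add1n exprMn_n -!mulrnA -expnM divnK.
exists g, ((g ^+ p)^-1 * h)%g; split; last by rewrite mulKVg.
  by rewrite inE.
by apply: (@congG_div _ _ _ (- c)); rewrite FinRing.val_unitX gc mulNrn addrK.
Qed.

(** * Comparison of the congruence and augmentation filtrations *)

Variables (k : fieldType) (u : nat) (A : algType k) (rho : {unit R} -> A).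
Hypotheses (pcharkp : p \in [pchar k]) (u_gt0 : (0 < u)%N).
Hypothesis (u_gt1 : p = 2%N -> (2 <= u)%N).
Hypothesis rho1 : rho 1%g = 1.
Hypothesis rhoM : {in congG u &, {morph rho : g h / (g * h)%g >-> g * h}}.
Local Notation aug := (augpow (fun g => g \in congG u) rho).

Lemma congG_morphX g n : g \in congG u -> rho (g ^+ n)%g = rho g ^+ n.
Proof.
move=> Gg; elim: n => [|n IHn]; first by rewrite expg0 rho1.
by rewrite expgS exprS -IHn rhoM ?groupX.
Qed.

Let pcharA : p \in [pchar A].
Proof. exact: (rmorph_pchar (in_alg A)). Qed.

(** Write [h] as [g ^+ p * h'] by [congG_root]. By Frobenius, [rho (g ^+ p) - 1] is the [p]-th power
    of [rho g - 1], which has degree [p ^ j] by induction, and [h'] lies one congruence level deeper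
    than [h]. *)
Lemma augpow_cong j h : h \in congG (u + j) -> aug (p ^ j) (rho h - 1).
Proof.
elim: j h => [|j IHj] h; first by rewrite addn0 expn0 => Gh; apply: augpow_gen.
(* Here [N] bounds the distance to level [M], where only the identity is left. *)
suff descent N : forall i h, (M <= i + N)%N -> (u + j <= i)%N ->
    h \in congG i.+1 -> aug (p ^ j.+1) (rho h - 1).
  by rewrite addnS; apply: (descent M); rewrite ?leq_addl.
elim: N => [|N IHN] i {}h le_M le_i.
  rewrite addn0 in le_M; rewrite inE => /(cong1_full (leqW le_M)) h1.
  suff -> : h = 1%g by rewrite rho1 subrr; apply: augpow0.
  exact: val_inj.
case/congG_root; [by lia | by lia |] => g [h' [Gg Gh' ->]].
have Gug : g \in congG u by apply: congG_leq Gg; lia.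
rewrite rhoM ?groupX //; last by apply: congG_leq Gh'; lia.
rewrite -[rho (g ^+ p)%g](subrK 1) mulrDl mul1r -addrA.
have aug_gp : aug (p ^ j.+1) (rho (g ^+ p)%g - 1).
  rewrite congG_morphX // -{2}[p]expn1 -(expr_pchar_sub1 _ _ pcharA) expn1 expnSr.
  by apply/augpowX/IHj; apply: congG_leq Gg.
apply: augpowD; last by apply: (IHN i.+1) => //; lia.
rewrite -[(p ^ j.+1)%N]addn0; apply: augpow_mul => //.
by apply: augpow_elt; apply: congG_leq Gh'; lia.
Qed.

(** Put [g * h = h * g * z]. The terms in [p ^ u] cancel in the difference of the two products, so
    [z] is 1 modulo [p ^ (u + u)] and [augpow_cong] gives degree [p ^ u >= 3]; for [p = 2] this
    takes [u >= 2]. *)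
Lemma augpow_commG g h : g \in congG u -> h \in congG u ->
  aug 3 (rho g * rho h - rho h * rho g).
Proof.
move=> Gg Gh; rewrite -!rhoM // -[(g * h)%g](mulKVg (h * g)%g).
set z := (_^-1 * _)%g.
have Gz : z \in congG (u + u).
  move: Gg Gh; rewrite 2!inE => /cong1P[b gb] /cong1P[c hc].
  apply: (@congG_div _ _ _ (b * c - c * b)).
  rewrite !FinRing.val_unitM gb hc !mulr_1D [c *+ _ + b *+ _]addrC.
  rewrite !mulrnAl !mulrnAr -!mulrnA -expnD mulrnBl.
  by rewrite [RHS](AC (2*2) (3*2*(1*4))) /= subrr addr0.
have Guz : z \in congG u by apply: congG_leq Gz; rewrite leq_addl.
have Ghg : (h * g)%g \in congG u by rewrite groupM.
rewrite (rhoM Ghg Guz).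
rewrite -[X in _ - X]mulr1 -mulrBr -[3%N]add0n; apply: augpow_mul.
  by apply: augpow_elt; rewrite groupM.
apply: augpow_leq (augpow_cong Gz).
have := prime_gt1 p_pr; rewrite leq_eqVlt => /orP[/eqP p2|p3].
  by have u2 := u_gt1 (esym p2); rewrite -p2; apply: (@leq_trans (2 ^ 2)); rewrite ?leq_exp2l.
by apply: leq_trans p3 _; rewrite -{1}[p]expn1 leq_exp2l ?prime_gt1.
Qed.

Lemma augpow_addG g h : g \in congG u -> h \in congG u ->
  aug 2 (rho (g * h)%g - 1 - ((rho g - 1) + (rho h - 1))).
Proof.
move=> Gg Gh; rewrite rhoM //.
have -> : rho g * rho h - 1 - (rho g - 1 + (rho h - 1)) = (rho g - 1) * (rho h - 1).
  have := mulr_1D (rho g - 1) (rho h - 1); rewrite ![1 + _]addrC !subrK => ->.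
  by rewrite [in LHS]addrA !addrK.
by apply: (@augpow_mul _ _ _ _ _ 1 1); apply: augpow_gen.
Qed.

Variables (D : nat) (e : 'I_D -> R) (E : 'I_D -> {unit R}).
Hypothesis valE : forall i, val (E i) = 1 + e i *+ p ^ u.
Hypothesis span_e : forall b : R, exists c : 'I_D -> nat, b = \sum_i e i *+ c i.

Lemma congG_E i : E i \in congG u.
Proof. by rewrite inE valE; apply/cong1P; exists (e i). Qed.

(** Coordinates [c] of [b] give a product of the [E i ^+ c i] that agrees with [g] modulo
    [p ^ u.+1]. The quotient of the two has degree [p >= 2] by [augpow_cong]. *)
Lemma augpow_genG g : g \in congG u -> exists c : 'I_D -> k,
  aug 2 (rho g - 1 - \sum_i c i *: (rho (E i) - 1)).
Proof.
rewrite inE => /cong1P[b gb]; have [c bc] := span_e b.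
(* Additivity of g |-> rho g - 1 modulo the second power, tracked with the value of g
   modulo p^(u+1). *)
pose P g (b : R) y := [/\ g \in congG u,
  exists d, val g = 1 + b *+ p ^ u + d *+ p ^ u.+1 & aug 2 (rho g - 1 - y)].
have P1 : P 1%g 0 0.
  split; first exact: group1.
    by exists 0; rewrite !mul0rn !addr0.
  by rewrite rho1 !subrr; apply: augpow0.
have PM g1 g2 b1 b2 y1 y2 :
    P g1 b1 y1 -> P g2 b2 y2 -> P (g1 * g2)%g (b1 + b2) (y1 + y2).
  move=> [G1 [d1 e1] F1] [G2 [d2 e2] F2]; split; first exact: groupM.
    pose w1 := b1 + d1 *+ p; pose w2 := b2 + d2 *+ p.
    (* The product of the two deviations carries [p ^ (u + u)], that is [p ^ u.+1] times [p ^ u.-1],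
       as [u] is positive. *)
    exists (d1 + d2 + w1 * w2 *+ p ^ u.-1).
    have wE (b' d' : R) : b' *+ p ^ u + d' *+ p ^ u.+1 = (b' + d' *+ p) *+ p ^ u.
      by rewrite mulrnDl -mulrnA -expnS.
    rewrite FinRing.val_unitM e1 e2 -!addrA !wE mulr_1D mulrnAl mulrnAr -mulrnA.
    rewrite -expnD -!wE !mulrnDl -mulrnA -expnD addnS -addSn prednK //.
    by rewrite [LHS](AC (1*((2*2)*1)) ((6*(2*4))*((3*5)*1))) /= -!addrA.
  have -> : rho (g1 * g2)%g - 1 - (y1 + y2) =
      rho (g1 * g2)%g - 1 - ((rho g1 - 1) + (rho g2 - 1))
      + ((rho g1 - 1 - y1) + (rho g2 - 1 - y2)).
    move: (rho g1 - 1) (rho g2 - 1) (rho _ - 1) => v w z.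
    by rewrite [v - _ + _]addrACA -opprD addrA subrK.
  by apply: augpowD (augpowD _ _) => //; apply: augpow_addG.
have PE i : P (E i) (e i) (rho (E i) - 1).
  split; first exact: congG_E.
    by exists 0; rewrite mul0rn addr0.
  by rewrite subrr; apply: augpow0.
have PX g1 b1 y1 n : P g1 b1 y1 -> P (g1 ^+ n)%g (b1 *+ n) (y1 *+ n).
  move=> P1'; elim: n => [|n IHn]; first by rewrite !mulr0n expg0.
  by rewrite expgS !mulrS; apply: PM.
have [g0 [G0 [d g0d] F0]] : exists g0, P g0 b (\sum_i (rho (E i) - 1) *+ c i).
  exists (\prod_i (E i ^+ c i))%g; rewrite bc.
  by apply: (big_rec3 P) => // i g1 b1 y1 _; apply/PM/PX/PE.
exists (fun i => (c i)%:R); under eq_bigr do rewrite scaler_nat.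
have Gh : (g0^-1 * g)%g \in congG (u + 1).
  by apply: (@congG_div _ _ _ (- d)); rewrite g0d addn1 mulNrn addrK.
have /augpow_cong := Gh; rewrite expn1 => /(augpow_leq (prime_gt1 p_pr)) Fh.
have {}Gh : (g0^-1 * g)%g \in congG u by apply: congG_leq Gh; rewrite leq_addr.
have := augpow_addG G0 Gh; rewrite mulKVg => Fg.
set s := \sum_i _ in F0 *.
have -> : rho g - 1 - s = rho g - 1 - ((rho g0 - 1) + (rho (g0^-1 * g)%g - 1))
   + (rho (g0^-1 * g)%g - 1) + (rho g0 - 1 - s).
  move: (rho g - 1) (rho g0 - 1) (rho (g0^-1 * g)%g - 1) => v w z.
  by rewrite opprD [v + (_ + _)]addrA subrK addrA subrK.
by apply: augpowD => //; apply: augpowD.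
Qed.

(** Frobenius moves the power inside [rho], where [cong1_exp1] makes it trivial. *)
Lemma congG_gen_exp0 i : (rho (E i) - 1) ^+ (p ^ (M - u)) = 0.
Proof.
rewrite (expr_pchar_sub1 _ _ pcharA) -congG_morphX ?congG_E //.
suff -> : (E i ^+ (p ^ (M - u)))%g = 1%g by rewrite rho1 subrr.
apply: val_inj; rewrite FinRing.val_unitX; apply: cong1_exp1 u_gt0 _.
by have := congG_E i; rewrite inE.
Qed.

Lemma card_congG :
  (forall c c' : {ffun 'I_D -> 'I_(p ^ (M - u))},
    \sum_i e i *+ (c i * p ^ u) = \sum_i e i *+ (c' i * p ^ u) -> c = c') ->
  ((p ^ (M - u)) ^ D <= #|congG u|)%N.
Proof.
move=> inj_e.
have <- : #|{ffun 'I_D -> 'I_(p ^ (M - u))}| = ((p ^ (M - u)) ^ D)%N.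
  by rewrite card_ffun !card_ord.
have cf (c : {ffun 'I_D -> 'I_(p ^ (M - u))}) :
    cong1 u (1 + \sum_i e i *+ (c i * p ^ u)).
  apply/cong1P; exists (\sum_i e i *+ c i); rewrite -sumrMnl.
  by congr (_ + _); apply: eq_bigr => i _; rewrite mulrnA.
pose f c := FinRing.unit R (cong1_unit u_gt0 (cf c)).
have f_inj : injective f by move=> c c' /(congr1 val)/= /addrI/inj_e.
rewrite -(card_imset _ f_inj) subset_leq_card //.
by apply/subsetP => _ /imsetP[c _ ->]; rewrite inE; apply: cf.
Qed.

End CongruenceGroups.

(** * Reduction morphisms and matrices over Z/p^M *)

Lemma cong1_rmorph (R R' : finUnitRingType) (f : {rmorphism R -> R'}) p i a :
  cong1 p i a -> cong1 p i (f a).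
Proof.
by move=> /cong1P[b ->]; apply/cong1P; exists (f b); rewrite rmorphD rmorph1 rmorphMn.
Qed.

Lemma Zp_natr0 m n : (1 < n)%N -> (n %| m)%N -> m%:R = 0 :> 'Z_n.
Proof. by move=> n_gt1 /dvdnP[c ->]; rewrite natrM pchar_Zp // mulr0. Qed.

Lemma Zp_rmorphism m n : (1 < n)%N -> (1 < m)%N -> (n %| m)%N ->
  inhabited {rmorphism 'Z_m -> 'Z_n}.
Proof.
move=> n_gt1 m_gt1 dvd_nm; pose f (z : 'Z_m) : 'Z_n := (nat_of_ord z)%:R.
have modE a : (a %% m)%:R = a%:R :> 'Z_n.
  by rewrite [in RHS](divn_eq a m) natrD natrM (Zp_natr0 n_gt1 dvd_nm) mulr0 add0r.
have fE a : f a%:R = a%:R by rewrite /f val_Zp_nat // modE.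
have fD y z : f (y + z) = f y + f z.
  by rewrite -[y]natr_Zp -[z]natr_Zp -natrD !fE natrD.
have fB : zmod_morphism f.
  by move=> y z; apply/eqP; rewrite eq_sym subr_eq -fD subrK.
have fM : monoid_morphism f.
  split; first exact: (fE 1%N).
  by move=> y z; rewrite -[y]natr_Zp -[z]natr_Zp -natrM !fE natrM.
pose fa := GRing.isZmodMorphism.Build _ _ f fB.
pose fm := GRing.isMonoidMorphism.Build _ _ f fM.
by constructor; exact: (HB.pack_for {rmorphism 'Z_m -> 'Z_n} f fa fm).
Qed.

Section MatrixLevel.
Variables (p M d : nat).
Hypotheses (p_pr : prime p) (M_gt0 : (0 < M)%N).
Local Notation R := 'M['Z_(p ^ M)]_d.+1.

Lemma pM_gt1 : (1 < p ^ M)%N.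
Proof. by rewrite -(exp1n M) ltn_exp2r ?prime_gt1. Qed.

Lemma mx_natr0 : (p ^ M)%:R = 0 :> R.
Proof.
by rewrite -(rmorph_nat (@scalar_mx _ d.+1)) Zp_natr0 ?pM_gt1 // raddf0.
Qed.

Let I := ('I_d.+1 * 'I_d.+1)%type.
Definition mxbase (i : 'I_#|{: I}|) : R := delta_mx (enum_val i).1 (enum_val i).2.

Lemma mxbase_sum (c : 'I_#|{: I}| -> nat) :
  \sum_i mxbase i *+ c i = \matrix_(a, b) (c (enum_rank (a, b)))%:R.
Proof.
apply/matrixP => a b; rewrite summxE mxE (bigD1 (enum_rank (a, b))) //= big1.
  by rewrite addr0 mulmxnE /mxbase mxE enum_rankK /= !eqxx.
move=> i ni; rewrite mulmxnE /mxbase mxE.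
case: eqP => [Ea|]; last by rewrite mul0rn.
case: eqP => [Eb|]; last by rewrite mul0rn.
by case/eqP: ni; rewrite Ea Eb -surjective_pairing enum_valK.
Qed.

Lemma mxbase_span (b : R) : exists c : 'I_#|{: I}| -> nat, b = \sum_i mxbase i *+ c i.
Proof.
exists (fun i => b (enum_val i).1 (enum_val i).2 : nat).
by rewrite mxbase_sum; apply/matrixP => i j; rewrite mxE enum_rankK natr_Zp.
Qed.

(** The entries [c i * p ^ u] stay below [p ^ M], so they are determined by their residues. *)
Lemma mxbase_inj u : (u <= M)%N ->
  forall c c' : {ffun 'I_#|{: I}| -> 'I_(p ^ (M - u))},
  \sum_i mxbase i *+ (c i * p ^ u) = \sum_i mxbase i *+ (c' i * p ^ u) -> c = c'.
Proof.
move=> le_uM c c'; rewrite !mxbase_sum => /matrixP ecc'; apply/ffunP => i.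
have := ecc' (enum_val i).1 (enum_val i).2; rewrite !mxE -surjective_pairing enum_valK.
move/(congr1 (@nat_of_ord _)); rewrite !val_Zp_nat ?pM_gt1 //.
have small (x : 'I_(p ^ (M - u))) : (x * p ^ u < p ^ M)%N.
  by rewrite -{2}(subnK le_uM) expnD ltn_pmul2r ?expn_gt0 ?prime_gt0.
rewrite !modn_small // => /eqP; rewrite eqn_pmul2r ?expn_gt0 ?prime_gt0 // => /eqP.
exact: val_inj.
Qed.

Variables (k : fieldType) (u : nat) (A : falgType k) (rho : {unit R} -> A) (L : nat).
Hypotheses (pcharkp : p \in [pchar k]) (u_gt0 : (0 < u)%N) (le_uM : (u <= M)%N).
Hypothesis (u_gt1 : p = 2%N -> (2 <= u)%N).
Local Notation G := (congG R p u).
Hypothesis rho1 : rho 1%g = 1.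
Hypothesis rhoM : {in G &, {morph rho : g h / (g * h)%g >-> g * h}}.
Hypothesis free_rho : free (image rho G).
Local Notation aug := (augpow (fun g => g \in G) rho).
Hypothesis nilp : forall a, aug L a -> a = 0.

(** Instance of [augpow_mul_neq0] with [q = p ^ (M - u)], the matrix units as directions, and [D]
    the number of matrix entries. *)
Lemma cong_mul_neq0 a b m n : (m + n <= p ^ (M - u))%N ->
  aug 0 a -> ~ aug m a -> aug 0 b -> ~ aug n b -> a * b <> 0.
Proof.
have pM0 := mx_natr0.
have congE i : cong1 p u (1 + mxbase i *+ p ^ u) by apply/cong1P; exists (mxbase i).
pose E i : {unit R} := FinRing.unit R (cong1_unit p_pr pM0 u_gt0 (congE i)).
have valE i : val (E i) = 1 + mxbase i *+ p ^ u by [].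
apply: (augpow_mul_neq0 (D := #|{: I}|) (e := E) (q := (p ^ (M - u))%N) (L := L)) => //.
- exact: (augpow_commG p_pr pM0 pcharkp u_gt0 u_gt1 rho1 rhoM).
- exact: (congG_E valE).
- exact: (augpow_genG p_pr pM0 pcharkp u_gt0 u_gt1 rho1 rhoM valE mxbase_span).
- exact: (card_congG p_pr pM0 u_gt0 (mxbase_inj le_uM)).
- exact: (congG_gen_exp0 pM0 pcharkp u_gt0 rho1 rhoM valE).
Qed.

End MatrixLevel.

(** * Formal sums over a type without decidable equality *)

Lemma eq_sum_In (V : nmodType) (T : Type) (f : seq T) (F H : T -> V) :
  (forall x, List.In x f -> F x = H x) -> \sum_(x <- f) F x = \sum_(x <- f) H x.
Proof.
elim: f => [|x f IHf] FH; first by rewrite !big_nil.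
by rewrite !big_cons FH ?IHf //=; [move=> y fy; apply: FH; right | left].
Qed.

(** Induction on the length: the terms sharing the group element of the first one contribute its
    coefficient, which is 0, times a single value. Removing them all leaves a shorter sum whose
    coefficients still vanish. *)
Lemma gr_coef_eval0 (k : nzRingType) (T : Type) (W : lmodType k) (t : T -> W)
    (f : seq (k * T)) :
  (forall g, gr_coef f g = 0) -> \sum_(x <- f) x.1 *: t x.2 = 0.
Proof.
move: {2}(size f) (leqnn (size f)) => n; elim: n f => [|n IHn] [|x f] //= szf f0.
- by rewrite big_nil.
- by rewrite big_nil.
pose P (y : k * T) := if excluded_middle_informative (y.2 = x.2) then true else false.
have PP y : reflect (y.2 = x.2) (P y).
  by rewrite /P; case: excluded_middle_informative => h; constructor.
rewrite (bigID P) /=.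
have -> : \sum_(y <- x :: f | P y) y.1 *: t y.2 = gr_coef (x :: f) x.2 *: t x.2.
  rewrite /gr_coef scaler_suml big_mkcond; apply: eq_bigr => y _.
  rewrite /P; case: excluded_middle_informative => /= [->|_] //.
  by rewrite scale0r.
rewrite f0 scale0r add0r -big_filter; apply: IHn => [|g].
  rewrite /=; have -> : P x = true by apply/PP.
  by rewrite -ltnS; apply: leq_ltn_trans szf; rewrite size_filter count_size.
rewrite /gr_coef big_filter.
case: (excluded_middle_informative (g = x.2)) => [->|gx].
  rewrite big1 // => y /PP yx.
  by case: excluded_middle_informative.
rewrite -[RHS](f0 g) /gr_coef [RHS](bigID P) /= [X in X + _]big1 ?add0r // => y /PP yx.
by case: excluded_middle_informative => // yg; case: gx; rewrite -yg.
Qed.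

(** * From compatible families of integer matrices to matrices modulo [p ^ M] *)

Section PadicLevels.
Variables (p d u : nat).
Hypothesis p_pr : prime p.
Local Notation R M := ('M['Z_(p ^ M)]_d.+1).
Local Notation Gamma := (@CS u d.+1 p).
Local Notation G M := (congG (R M) p u).
Implicit Types (A B : padic_mx d.+1) (M N : nat).

Definition red_mx M (X : 'M[int]_d.+1) : R M := map_mx (intmul 1) X.

Lemma red_mx_mod M X : (0 < M)%N -> red_mx M (mod_mx (p ^ M)%N%:Z X) = red_mx M X.
Proof.
move=> M_gt0; apply/matrixP => i j; rewrite !mxE.
rewrite [in RHS](divz_eq (X i j) (p ^ M)%N) [RHS]intrD intrM -pmulrn.
by rewrite (Zp_natr0 (pM_gt1 p_pr M_gt0)) // mulr0 add0r.
Qed.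

Lemma red_mx_inj M X Y : (0 < M)%N -> red_mx M X = red_mx M Y ->
  mod_mx (p ^ M)%N%:Z X = mod_mx (p ^ M)%N%:Z Y.
Proof.
move=> M_gt0 /matrixP eXY; apply/matrixP => i j; move: (eXY i j); rewrite !mxE.
have q_gt0 : (0 < p ^ M)%N by rewrite expn_gt0 prime_gt0.
have modE (z : int) : (z %% (p ^ M)%N)%Z = nat_of_ord (z%:~R : 'Z_(p ^ M)) :> int.
  rewrite {2}(divz_eq z (p ^ M)%N) [in RHS]intrD intrM -[(p ^ M)%N%:~R]pmulrn.
  rewrite (Zp_natr0 (pM_gt1 p_pr M_gt0)) // mulr0 add0r.
  have : (0 <= (z %% (p ^ M)%N)%Z)%R by rewrite modz_ge0 //; lia.
  have : ((z %% (p ^ M)%N)%Z < (p ^ M)%N%:Z)%R by rewrite ltz_pmod //; lia.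
  case: (z %% (p ^ M)%N)%Z => // r ltr _.
  by rewrite -pmulrn val_Zp_nat ?pM_gt1 // modn_small //; lia.
by rewrite !modE => ->.
Qed.

Lemma padic_mod A M N : is_padic_mx p A -> (N <= M)%N ->
  A N = mod_mx (p ^ N)%N%:Z (A M).
Proof.
move=> pA /subnK <-; elim: (M - N)%N => [|n IHn].
  (* [A N] is itself a remainder modulo [p ^ N], so reducing it again changes nothing. *)
  rewrite pA; apply/matrixP => i j; rewrite !mxE modz_mod //.
rewrite IHn addSn [A (n + N)%N]pA; apply/matrixP => i j; rewrite !mxE.
set z := A _ i j; rewrite [in RHS](divz_eq z (p ^ (n + N))%N).
by rewrite [X in (_ * X + _)](_ : _ = (p ^ n)%N%:Z * (p ^ N)%N%:Z)
  ?mulrA ?modzMDl // -PoszM -expnD.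
Qed.

Lemma red_padic_cong A M : Gamma A -> (0 < M)%N -> (u <= M)%N ->
  cong1 p u (red_mx M (A M)).
Proof.
move=> [pA Au] M_gt0 le_uM; move: Au; rewrite (padic_mod pA le_uM) => /matrixP Au.
pose B : 'M[int]_d.+1 := \matrix_(i, j) ((A M i j - (1%:M : 'M_d.+1) i j) %/ (p ^ u)%N)%Z.
have -> : A M = 1%:M + B *+ p ^ u.
  apply/matrixP => i j; rewrite [RHS]mxE mulmxnE [B i j]mxE -mulr_natr.
  rewrite natz divzK ?subrKC //.
  by move: (Au i j); rewrite !mxE => /eqP; rewrite eqz_mod_dvd.
apply/cong1P; exists (red_mx M B); rewrite /red_mx map_mxD map_mx1; congr (_ + _).
apply/matrixP => i j; rewrite mulmxnE ![map_mx _ _ i j]mxE mulmxnE.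
by rewrite raddfMn.
Qed.

(** The default 1 is returned when the reduction is not a unit; by [val_level] this does not happen
    on [Gamma] from level [u] on. *)
Definition level M A : {unit R M} := insubd (1%g : {unit R M}) (red_mx M (A M)).

Variable M : nat.
Hypotheses (M_gt0 : (0 < M)%N) (u_gt0 : (0 < u)%N) (le_uM : (u <= M)%N).

Lemma val_level A : Gamma A -> val (level M A) = red_mx M (A M).
Proof.
move=> GA; rewrite val_insubd ifT //.
exact: (cong1_unit p_pr (mx_natr0 d p_pr M_gt0) u_gt0 (red_padic_cong GA M_gt0 le_uM)).
Qed.

Lemma level_cong A : Gamma A -> level M A \in G M.
Proof. by move=> GA; rewrite inE val_level //; apply: red_padic_cong. Qed.

Lemma levelM A B : Gamma A -> Gamma B ->
  level M (padic_mul p A B) = (level M A * level M B)%g.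
Proof.
move=> GA GB; apply: val_inj; rewrite FinRing.val_unitM.
have E : red_mx M (padic_mul p A B M) = val (level M A) * val (level M B).
  by rewrite red_mx_mod // !val_level // /red_mx map_mxM.
by rewrite val_insubd E -FinRing.val_unitM ifT //; apply: valP.
Qed.

Lemma level_inj A B : Gamma A -> Gamma B -> level M A = level M B -> A M = B M.
Proof.
move=> GA GB /(congr1 val); rewrite !val_level // => /(red_mx_inj M_gt0).
by case: GA GB => pA _ [pB _]; rewrite -!(padic_mod _ (leqnn M)).
Qed.

End PadicLevels.

(** * Images of k[Gamma] in the finite group algebras *)

Section PadicGroupRing.
Variables (p d u : nat) (k : fieldType).
Hypotheses (p_pr : prime p) (u_gt0 : (0 < u)%N) (pcharkp : p \in [pchar k]).
Local Notation R M := ('M['Z_(p ^ M)]_d.+1).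
Local Notation Gamma := (@CS u d.+1 p).
Local Notation G M := (congG (R M) p u).
Local Notation aug M rho := (augpow (fun g => g \in G M) rho).
Implicit Types (A B : padic_mx d.+1) (M N : nat).

Lemma level_reduction M N (F : {rmorphism 'Z_(p ^ M) -> 'Z_(p ^ N)})
    (f : {unit R M} -> {unit R N}) :
  (u <= N <= M)%N -> (forall g, val (f g) = map_mx F (val g)) ->
  forall A, Gamma A -> f (level p M A) = level p N A.
Proof.
case/andP=> le_uN le_NM fE A GA; apply: val_inj.
have N_gt0 := leq_trans u_gt0 le_uN.
have le_uM := leq_trans le_uN le_NM; have M_gt0 := leq_trans u_gt0 le_uM.
rewrite fE !(val_level p_pr _ u_gt0 _ GA) //; case: GA => pA _.
rewrite (padic_mod pA le_NM) red_mx_mod //.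
by apply/matrixP => i j; rewrite !mxE rmorph_int.
Qed.

Lemma reduction_exists M N : (u <= N <= M)%N -> exists f : {unit R M} -> {unit R N},
  [/\ {in G M, forall g, f g \in G N}, f 1%g = 1%g,
      {morph f : g h / (g * h)%g}
    & forall A, Gamma A -> f (level p M A) = level p N A].
Proof.
move=> le_uNM; have /andP[le_uN le_NM] := le_uNM.
have N_gt0 := leq_trans u_gt0 le_uN; have M_gt0 := leq_trans N_gt0 le_NM.
have [F] := Zp_rmorphism (pM_gt1 p_pr N_gt0) (pM_gt1 p_pr M_gt0) (dvdn_exp2l p le_NM).
pose f (g : {unit R M}) : {unit R N} := insubd (1%g : {unit R N}) (map_mx F (val g)).
have fE g : val (f g) = map_mx F (val g).
  by rewrite val_insubd ifT //; apply: rmorph_unit; apply: valP.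
exists f; split; last exact: level_reduction fE.
- by move=> g; rewrite !inE fE; apply: cong1_rmorph.
- by apply: val_inj; rewrite fE map_mx1.
- by move=> g h; apply: val_inj; rewrite FinRing.val_unitM !fE FinRing.val_unitM rmorphM.
Qed.

(** Different families differ at some index, hence at every later one, since each term determines
    the earlier ones; finitely many terms have a common bound. *)
Lemma padic_separated (f : seq (k * padic_mx d.+1)) B :
  gr_supported Gamma f -> Gamma B -> exists N0, forall N, (N0 <= N)%N ->
  forall x, List.In x f -> x.2 <> B -> x.2 N <> B N.
Proof.
elim: f => [|x f IHf] Gf GB; first by exists 0%N.
have [|N1 sep1] := IHf _ GB; first by move=> y fy; apply: Gf; right.
have [xB|xB] := classic (x.2 = B).
  by exists N1 => N le_N y [<-//|]; apply: sep1.
have [n xBn] : exists n, x.2 n <> B n.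
  by apply: not_all_ex_not => xBn; apply/xB/functional_extensionality.
exists (maxn n N1) => N; rewrite geq_max => /andP[le_nN le_N] y [<- _|]; last exact: sep1.
have [px _] := Gf x (or_introl erefl); have [pB _] := GB.
by move=> xBN; apply: xBn; rewrite (padic_mod px le_nN) xBN -padic_mod.
Qed.

Definition gr_level M (A : falgType k) (rho : {unit R M} -> A)
  (f : seq (k * padic_mx d.+1)) : A := \sum_(x <- f) x.1 *: rho (level p M x.2).

(** At a level separating [B] from the other elements in [f], the image of [f] still has coefficient
    [gr_coef f B] at the image of [B]. *)
Lemma gr_level_neq0 f : gr_supported Gamma f -> gr_nonzero f ->
  exists N, (u <= N)%N /\ forall (A : falgType k) (rho : {unit R N} -> A),
    free (image rho (G N)) -> gr_level rho f <> 0.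
Proof.
move=> Gf [B fB].
have GB : Gamma B.
  apply: NNPP => nGB; case/eqP: fB; rewrite /gr_coef.
  rewrite (@eq_sum_In _ _ _ _ (fun=> 0)) ?big1 // => x /Gf Gx.
  by case: excluded_middle_informative => //= xB; case: nGB; rewrite -xB.
have [N0 sep] := padic_separated Gf GB.
exists (maxn u N0); rewrite leq_maxl; split=> // A rho free_rho f0.
set N := maxn u N0 in A rho free_rho f0 *.
have le_uN : (u <= N)%N by apply: leq_maxl.
have N_gt0 := leq_trans u_gt0 le_uN.
(* [F] is the coefficient functional at the image of [B]. *)
have [F FE] := linear_extension (fun g => (g == level p N B)%:R : k^o) free_rho.
case/eqP: fB; transitivity (F (gr_level rho f)); last by rewrite f0 linear0.
rewrite linear_sum; apply: eq_sum_In => x fx; have Gx := Gf x fx.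
rewrite linearZ /= FE ?level_cong //.
case: excluded_middle_informative => /= [->|xB].
  by rewrite eqxx; symmetry; apply: mulr1.
case: eqP => [/level_inj|_]; last by rewrite scaler0.
move=> /(_ u p_pr N_gt0 u_gt0 le_uN Gx GB) xBN.
by case: (sep N (leq_maxr _ _) x fx xB xBN).
Qed.

Lemma gr_level_aug M (A : falgType k) (rho : {unit R M} -> A) f :
  (u <= M)%N -> gr_supported Gamma f -> aug M rho 0 (gr_level rho f).
Proof.
move=> le_uM; have M_gt0 := leq_trans u_gt0 le_uM.
elim: f => [|x f IHf] Gf; first by rewrite /gr_level big_nil; apply: augpow0.
rewrite /gr_level big_cons; apply: augpowP; last by apply: IHf => y fy; apply: Gf; right.
by apply: augpow_elt; apply: level_cong => //; apply: Gf; left.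
Qed.

(** [K] is the nilpotency exponent at one level [N] where the image is nonzero, so it does not
    depend on [M]: reduction from level [M] to [N] respects the filtrations, and the [K]-th ideal
    power at level [N] is 0. *)
Lemma gr_level_bound f : gr_supported Gamma f -> gr_nonzero f ->
  exists N K, (u <= N)%N /\ forall M (A : falgType k) (rho : {unit R M} -> A),
    (N <= M)%N -> rho 1%g = 1 ->
    {in G M &, {morph rho : g h / (g * h)%g >-> g * h}} ->
    free (image rho (G M)) -> ~ aug M rho K (gr_level rho f).
Proof.
move=> Gf f0; have [N [le_uN fN]] := gr_level_neq0 Gf f0.
have N_gt0 := leq_trans u_gt0 le_uN.
have pG := congG_pgroup p_pr (mx_natr0 d p_pr N_gt0) u_gt0.
have [B [sigma [sig1 sigM free_sig nilB]]] := group_algebra_exists pcharkp pG.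
exists N, #|G N|; split=> // M A rho le_NM rho1 rhoM free_rho aug_f.
have M_gt0 := leq_trans N_gt0 le_NM; have le_uM := leq_trans le_uN le_NM.
have [|r [rG r1 rM rE]] := @reduction_exists M N; first by rewrite le_uN.
have [F FE] := linear_extension (fun g => sigma (r g)) free_rho.
apply: (fN _ _ free_sig); apply: nilB.
have -> : gr_level sigma f = F (gr_level rho f).
  rewrite linear_sum; apply: eq_sum_In => x /Gf Gx.
  by rewrite linearZ /= FE ?level_cong // rE.
apply: (augpow_morph rho1 rhoM sig1 sigM rG r1 _ FE aug_f).
by move=> g h _ _; apply: rM.
Qed.

Lemma gr_levelM M (A : falgType k) (rho : {unit R M} -> A) f h : (u <= M)%N ->
  {in G M &, {morph rho : g h / (g * h)%g >-> g * h}} ->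
  gr_supported Gamma f -> gr_supported Gamma h ->
  gr_level rho (gr_mul (@padic_mul p d.+1) f h) = gr_level rho f * gr_level rho h.
Proof.
move=> le_uM rhoM Gf Gh; have M_gt0 := leq_trans u_gt0 le_uM.
rewrite /gr_level big_allpairs_dep /= mulr_suml; apply: eq_sum_In => x /Gf Gx.
rewrite mulr_sumr; apply: eq_sum_In => y /Gh Gy /=.
rewrite (levelM p_pr M_gt0 u_gt0 le_uM Gx Gy) rhoM ?level_cong //.
by rewrite -scalerAl -scalerAr scalerA.
Qed.

End PadicGroupRing.

Theorem theorem1p2 (p d u : nat) (k : fieldType) :
  prime p -> (0 < d)%N -> (0 < u)%N -> (p = 2%N -> (2 <= u)%N) ->
  p \in [pchar k]%R ->
  @group_ring_domain k (padic_mx d) (@CS u d p) (@padic_mul p d).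
Proof.
case: d => // d p_pr _ u_gt0 u_gt1 pcharkp f h Gf Gh f0 h0.
apply: NNPP => fh0.
have [N1 [K1 [le_uN1 bound_f]]] := gr_level_bound p_pr u_gt0 pcharkp Gf f0.
have [N2 [K2 [le_uN2 bound_h]]] := gr_level_bound p_pr u_gt0 pcharkp Gh h0.
(* As [N1 >= u], this [M] is above both levels and satisfies [K1 + K2 <= M - u], hence
   [K1 + K2 <= p ^ (M - u)]. *)
pose M := (N1 + N2 + (K1 + K2))%N.
have le_uM : (u <= M)%N by rewrite /M; lia.
have M_gt0 := leq_trans u_gt0 le_uM.
have pG := congG_pgroup p_pr (mx_natr0 d p_pr M_gt0) u_gt0.
have [A [rho [rho1 rhoM free_rho nilA]]] := group_algebra_exists pcharkp pG.
apply: (@cong_mul_neq0 p M d p_pr M_gt0 k u A rho _ pcharkp u_gt0 le_uM u_gt1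
  rho1 rhoM free_rho nilA (gr_level rho f) (gr_level rho h) K1 K2).
- apply: leq_trans (ltnW (ltn_expl _ (prime_gt1 p_pr))); rewrite /M; lia.
- exact: gr_level_aug.
- by apply: bound_f => //; rewrite /M; lia.
- exact: gr_level_aug.
- by apply: bound_h => //; rewrite /M; lia.
(* The product of the images is the image of the product, whose coefficients all vanish by [fh0]. *)
rewrite -(gr_levelM p_pr u_gt0 le_uM rhoM Gf Gh).
apply: (gr_coef_eval0 (fun B => rho (level p M B))) => g.
by apply/eqP/negPn/negP => g0; apply: fh0; exists g.
Qed.
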